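(* Let $H=\langle n_1,n_2,n_3,n_4\rangle$ be a numerical semigroup minimally generated by $4$ elements such that $\mathrm F(H)/2\in \mathrm{PF}(H)$, and suppose that a row-factorization matrix of $\mathrm F(H)/2$ is $$\begin{pmatrix} -1 & \alpha_2-1 & 0 & 0\\ 0 & -1 & \alpha_3-1 & 0\\ \alpha_1-1 & 0 & -1 & \alpha_4-1\\ \alpha_1-1 & \alpha_{42} & 0 & -1\end{pmatrix},$$ where $\alpha_{42}$ is a non-negative integer. Then: (i) $\mathrm F(H)+n_2$ has unique factorization, and $n_2=\alpha_1\alpha_4(\alpha_3-1)+1$. (ii) The ideal $I_H\subset K[x_1,x_2,x_3,x_4]$ is generated by $\mathrm{RF}(\mathrm F(H)/2)$-relations; namely $$I_H=\bigl(x_2^{\alpha_2}-x_1x_3^{\alpha_3-1},\ x_1^{\alpha_1}-x_2^{\alpha_2-1-\alpha_{42}}x_4,\ x_3^{\alpha_3}-x_1^{\alpha_1-1}x_2x_4^{\alpha_4-1},\ x_3^{\alpha_3-1}x_4-x_1^{\alpha_1-1}x_2^{\alpha_{42}+1},\ x_4^{\alpha_4}-x_2^{\alpha_{42}}x_3\bigr)$$ (the relation obtained from the difference of the first and third rows of the matrix is not a minimal generator of $I_H$). (iii) $H$ is almost symmetric and $t(H)=2$.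
   Context: A numerical semigroup is a submonoid $H\subset\mathbb N$ with $0\in H$ and $\mathbb N\setminus H$ finite; we assume $H\ne\mathbb N$. $\mathrm F(H)=\max(\mathbb N\setminus H)$; $\mathrm{PF}(H)=\{f\in\mathbb Z\setminus H : f+n_i\in H\text{ for all }i\}$; the type is $t(H)=|\mathrm{PF}(H)|$; $H$ is almost symmetric if $2|\mathbb N\setminus H|=\mathrm F(H)+t(H)$. For each $i$, $\alpha_i$ is the smallest positive integer such that $\alpha_in_i=\sum_{j\ne i}\alpha_{ij}n_j$ for some non-negative integers $\alpha_{ij}$. For $f\in\mathrm{PF}(H)$, a row-factorization matrix of $f$ is an $e\times e$ integer matrix $(a_{ij})$ ($e$ = number of minimal generators) with $a_{ii}=-1$, $a_{ij}\in\mathbb N$ for $i\neq j$, and $\sum_j a_{ij}n_j=f$ for every $i$. $K$ is a field and $I_H$ is the kernel of the $K$-algebra map $K[x_1,\dots,x_e]\to K[t]$, $x_i\mapsto t^{n_i}$. If $\mathbf a_1,\dots,\mathbf a_e$ are the rows of a row-factorization matrix of $f$ and $\mathbf a_{ij}=\mathbf a_i-\mathbf a_j$ ($i<j$), the binomial $x^{\mathbf a_{ij}^+}-x^{\mathbf a_{ij}^-}\in I_H$ is called an $\mathrm{RF}(f)$-relation; here $\mathbf a^+$ is obtained from $\mathbf a$ by replacing negative entries by $0$ and $\mathbf a^-=\mathbf a^+-\mathbf a$. An element $h\in H$ has unique factorization if there is exactly one tuple $(c_1,\dots,c_e)\in\mathbb N^e$ with $h=\sum c_jn_j$. *)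

(* Defs.v *)
From HB Require Import structures.
From mathcomp Require Import all_boot all_order all_algebra finmap.
From mathcomp Require Import boolp classical_sets functions cardinality.
From mathcomp Require Import mpoly.

Set Implicit Arguments.
Unset Strict Implicit.
Unset Printing Implicit Defensive.

Import Order.TTheory GRing.Theory Num.Theory.

Local Open Scope classical_set_scope.
Local Open Scope ring_scope.

Section NumericalSemigroups.

Definition numerical_semigroup (H : set nat) : Prop :=
  [/\ H 0%N, (forall a b, H a -> H b -> H (a + b)%N),
      finite_set (~` H) & H <> setT].

Definition gaps (H : set nat) : {fset nat} := fset_set (~` H).

Definition Frobenius (H : set nat) : nat := \max_(g <- gaps H) g.

Variable e : nat.
Implicit Types (n : 'I_e -> nat) (H : set nat).

Definition span_nat n (J : {set 'I_e}) : set nat :=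
  [set h | exists c : 'I_e -> nat, h = (\sum_(j in J) c j * n j)%N].

Definition minimally_generated H n : Prop :=
  H = span_nat n [set: 'I_e]%SET /\
  forall J : {set 'I_e}, J \proper [set: 'I_e]%SET -> span_nat n J <> H.

Definition PF H n : set int :=
  [set f : int | ~ (Posz @` H) f /\ forall i, (Posz @` H) (f + (n i)%:Z)].

(* [fset_set] is only meaningful on finite sets; see [finite_PF] below *)
Definition sgtype H n : nat := #|` fset_set (PF H n)|.

Definition almost_symmetric H n : Prop :=
  (2 * #|` gaps H| = Frobenius H + sgtype H n)%N.

Definition unique_factorization n (h : nat) : Prop :=
  exists! c : {ffun 'I_e -> nat}, h = (\sum_j c j * n j)%N.

Definition is_alpha n (i : 'I_e) (a : nat) : Prop :=
  [/\ (0 < a)%N, span_nat n [set~ i]%SET (a * n i)%N &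
      forall b, (0 < b)%N -> span_nat n [set~ i]%SET (b * n i)%N -> (a <= b)%N].

Definition RF_matrix H n (f : int) (A : 'M[int]_e) : Prop :=
  [/\ PF H n f, (forall i, A i i = -1),
      (forall i j, i != j -> 0 <= A i j) &
      (forall i, \sum_j A i j * (n j)%:Z = f)].

Lemma finite_PF H n : (0 < e)%N -> numerical_semigroup H -> finite_set (PF H n).
Proof.
move=> e0 [_ _ Hfin _]; pose i0 := Ordinal e0.
apply: (@sub_finite_set _ _
  ((Posz @` (~` H)) `|` ((fun k : nat => - k%:Z) @` `I_(n i0).+1))); last first.
  by rewrite finite_setU; split; apply: finite_image => //; exact: finite_II.
move=> [k|k] /= [Hf Hn].
  by left; exists k => // Hk; apply: Hf; exists k.
right; exists k.+1; last by rewrite NegzE.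
by have [m _] := Hn i0; rewrite NegzE ltnS -lez_nat => E; rewrite -subr_ge0
  addrC -E.
Qed.

End NumericalSemigroups.

Section Ideals.

Definition ideal_gen (R : comNzRingType) (gs : seq R) : set R :=
  [set p | exists c : 'I_(size gs) -> R, p = \sum_(i < size gs) c i * gs`_i].

Variables (e : nat) (K : fieldType).
Implicit Types (n : 'I_e -> nat) (p : {mpoly K[e]}) (I : set {mpoly K[e]}).

Definition toric_ideal n : set {mpoly K[e]} :=
  [set p | mmap (@polyC K) (fun i => 'X^(n i)) p = 0].

(* homogeneity for the grading with deg x_i = n_i, for which the ideal of a
   numerical semigroup is homogeneous *)
Definition whomog n p : Prop :=
  exists d : nat, forall m, m \in msupp p -> (\sum_i m i * n i = d)%N.

(* Homogeneity cannot be dropped: {x^2, x + x^2} is an irredundant generating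
   system of the ideal (x) of K[x]. *)
Definition minimal_system n I (gs : seq {mpoly K[e]}) : Prop :=
  [/\ (forall g, g \in gs -> whomog n g), I = ideal_gen gs &
      (forall g, g \in gs -> ideal_gen (rem g gs) <> I)].

Definition minimal_generator n I p : Prop :=
  exists gs, minimal_system n I gs /\ p \in gs.

Definition pos_part (a : 'rV[int]_e) : 'X_{1..e} :=
  [multinom `|Num.max (a ord0 j) 0|%N | j < e].

Definition neg_part (a : 'rV[int]_e) : 'X_{1..e} :=
  [multinom `|(pos_part a j)%:Z - a ord0 j|%N | j < e].

Definition RF_binomial (A : 'M[int]_e) (i j : 'I_e) : {mpoly K[e]} :=
  let a := row i A - row j A in 'X_[pos_part a] - 'X_[neg_part a].

Definition RF_relation (H : set nat) n (f : int) p : Prop :=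
  exists A (i j : 'I_e),
    [/\ RF_matrix H n f A, (i < j)%N & p = RF_binomial A i j].

Definition generated_by_RF_relations (H : set nat) n (f : int) I : Prop :=
  exists gs, (forall g, g \in gs -> RF_relation H n f g) /\ I = ideal_gen gs.

End Ideals.

Arguments toric_ideal {e} K n.

Definition i1 : 'I_4 := @Ordinal 4 0 isT.
Definition i2 : 'I_4 := @Ordinal 4 1 isT.
Definition i3 : 'I_4 := @Ordinal 4 2 isT.
Definition i4 : 'I_4 := @Ordinal 4 3 isT.

Definition matrix4 (rows : seq (seq int)) : 'M[int]_4 :=
  \matrix_(i < 4, j < 4) (nth [::] rows i)`_j.

(* Main.v *)
(** The relations coming from the rows of the matrix show that a monomial of
    value [F + n2], where [F = 2 f], can only be
    [x1^(a1 - 1) x3^(a3 - 2) x4^(a4 - 1)]: any other shape would let one subtract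
    [n2] and exhibit [f] or [F] as an element of the semigroup.  Hence the
    divisors of this monomial, together with [x3^(a3 - 1)] (of value [f + n2]),
    have distinct values modulo [n2]; they are exactly the Apery set of [n2],
    because rewriting any other monomial with the five binomials raises the
    exponent of [x2].  This single rewriting argument gives the formula for
    [n2], the pseudo-Frobenius numbers [f] and [F], the symmetry [x |-> F - x]
    of the gaps other than [f], and the generation of the toric ideal.  The
    difference of the first and third rows is redundant since it is a
    combination of two other relations with non-constant coefficients, hence of
    relations of smaller weighted degree. *)

Require Import Defs.
From HB Require Import structures.
From mathcomp Require Import all_boot all_order all_algebra finmap.
From mathcomp Require Import boolp classical_sets functions cardinality.
From mathcomp Require Import mpoly zify ring.

Set Implicit Arguments.
Unset Strict Implicit.
Unset Printing Implicit Defensive.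

Import Order.TTheory GRing.Theory Num.Theory.
Local Open Scope ring_scope.

(** * Ideals as subsets of a commutative ring, and generation by finite sequences *)

Section IdealGen.
Variable R : comNzRingType.
Implicit Types (gs : seq R) (p g : R).

(** Common interface to [ideal_gen gs] and [toric_ideal K n], both of which are plain sets of ring
    elements. *)
Record ideal_closed (J : set R) : Prop := IdealClosed {
  ideal_closed0 : J 0;
  ideal_closedD : forall x y, J x -> J y -> J (x + y);
  ideal_closedM : forall c x, J x -> J (c * x) }.

Lemma ideal_closed_sum (J : set R) (I : Type) (r : seq I) (P : pred I)
    (F : I -> R) :
  ideal_closed J -> (forall i, P i -> J (F i)) -> J (\sum_(i <- r | P i) F i).
Proof. by case=> J0 JD _ JF; elim/big_ind: _. Qed.

Lemma ideal_closedN (J : set R) x : ideal_closed J -> J x -> J (- x).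
Proof. by case=> _ _ JM Jx; rewrite -mulN1r; exact: JM. Qed.

Lemma ideal_closedB (J : set R) x y :
  ideal_closed J -> J x -> J y -> J (x - y).
Proof.
by move=> JI Jx Jy; exact: (ideal_closedD JI Jx (ideal_closedN JI Jy)).
Qed.

Lemma ideal_gen_closed gs : ideal_closed (ideal_gen gs).
Proof.
split=> [|x y [c ->] [d ->]|a x [c ->]].
- by exists (fun=> 0); rewrite big1 // => i _; rewrite mul0r.
- exists (fun i => c i + d i); rewrite -big_split /=.
  by apply: eq_bigr => i _; rewrite mulrDl.
exists (fun i => a * c i); rewrite mulr_sumr.
by apply: eq_bigr => i _; rewrite mulrA.
Qed.

Lemma mem_ideal_gen gs g : g \in gs -> ideal_gen gs g.
Proof.
move=> ggs; have lt_g : (index g gs < size gs)%N by rewrite index_mem.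
exists (fun i => (i == Ordinal lt_g)%:R).
rewrite (bigD1 (Ordinal lt_g)) //= eqxx mul1r nth_index // big1 ?addr0 //.
by move=> i /negPf ->; rewrite mul0r.
Qed.

Lemma ideal_gen_opp gs g : (g \in gs) || (- g \in gs) -> ideal_gen gs g.
Proof.
case/orP=> /mem_ideal_gen // Ng; rewrite -[g]opprK.
exact: ideal_closedN (ideal_gen_closed gs) Ng.
Qed.

Lemma ideal_gen_min gs (J : set R) :
  ideal_closed J -> (forall g, g \in gs -> J g) ->
  forall p, ideal_gen gs p -> J p.
Proof.
move=> JI Jgs p [c ->]; apply: ideal_closed_sum => // i _.
by apply: (ideal_closedM JI); apply: Jgs; exact: mem_nth.
Qed.

Lemma eq_ideal_gen gs gs' :
  (forall g, g \in gs -> ideal_gen gs' g) ->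
  (forall g, g \in gs' -> ideal_gen gs g) -> ideal_gen gs = ideal_gen gs'.
Proof.
move=> s12 s21; apply/seteqP.
by split; apply: ideal_gen_min => //; exact: ideal_gen_closed.
Qed.

End IdealGen.

(** * Weighted degree, binomials in toric ideals, and minimal homogeneous generators *)

Section WeightedDegree.
Variables (e : nat) (n : 'I_e -> nat).

Definition wdeg (m : 'X_{1..e}) : nat := (\sum_i m i * n i)%N.

Lemma wdegD m1 m2 : wdeg (m1 + m2)%MM = (wdeg m1 + wdeg m2)%N.
Proof.
by rewrite -big_split /=; apply: eq_bigr => i _; rewrite mnmDE mulnDl.
Qed.

Lemma wdegU i : wdeg U_(i) = n i.
Proof.
rewrite /wdeg (bigD1 i) //= mnm1E eqxx mul1n big1 ?addn0 // => j ne_ji.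
by rewrite mnm1E eq_sym (negPf ne_ji).
Qed.

Variable K : fieldType.
Implicit Types (p u : {mpoly K[e]}) (gs : seq {mpoly K[e]}).

Definition whdeg d p := forall m, m \in msupp p -> wdeg m = d.

Lemma whdegXB d m1 m2 :
  wdeg m1 = d -> wdeg m2 = d -> whdeg d ('X_[m1] - 'X_[m2]).
Proof.
move=> d1 d2 m /msuppB_le; rewrite mem_cat !msuppX !inE.
by case/orP => /eqP ->.
Qed.

Lemma toric_map1E m : mmap1 (fun i => 'X^(n i)) m = 'X^(wdeg m) :> {poly K}.
Proof.
rewrite /mmap1 /wdeg; elim/big_rec2: _ => [|i y x _ ->] //=.
by rewrite exprD mulnC exprM.
Qed.

Lemma toric_ideal_closed : ideal_closed (toric_ideal K n).
Proof.
rewrite /toric_ideal; split=> [|x y /= Ix Iy|c x /= Ix].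
- exact: mmap0.
- by rewrite mmapD Ix Iy addr0.
by rewrite rmorphM /= Ix mulr0.
Qed.

Lemma toric_idealXB m1 m2 :
  wdeg m1 = wdeg m2 -> toric_ideal K n ('X_[m1] - 'X_[m2]).
Proof.
by move=> E; rewrite /toric_ideal /= mmapB !mmapX !toric_map1E E subrr.
Qed.

(** A toric ideal is spanned by binomials: replacing every monomial of [p] by a fixed one of the
    same weight changes [p] by a combination of binomials, and what remains vanishes because [p]
    maps to 0. *)
Lemma toric_ideal_min (J : set {mpoly K[e]}) :
  ideal_closed J ->
  (forall m1 m2, wdeg m1 = wdeg m2 -> J ('X_[m1] - 'X_[m2])) ->
  forall p, toric_ideal K n p -> J p.
Proof.
move=> JI JX p Ip.
(* The chosen representative of weight [d] in the support; the default [0%MM] is only reached for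
   weights that do not occur. *)
pose rho d := nth 0%MM [seq m <- msupp p | wdeg m == d] 0.
have wrho m : m \in msupp p -> wdeg (rho (wdeg m)) = wdeg m.
  move=> mp; apply/eqP; rewrite /rho.
  suff /(mem_nth 0%MM) : (0 < size [seq m' <- msupp p | wdeg m' == wdeg m])%N.
    by rewrite mem_filter => /andP[].
  by rewrite size_filter -has_count; apply/hasP; exists m.
(* This sum is the image of the zero polynomial [mmap ... p] under the linear map sending ['X^d] to
   ['X_[rho d]]; the bound [k] exceeds every weight in the support. *)
have L0 : \sum_(m <- msupp p) p@_m *: ('X_[rho (wdeg m)] : {mpoly K[e]}) = 0.
  pose k := (\max_(m <- msupp p) wdeg m).+1.
  have <- : \sum_(i < k) (mmap (@polyC K) (fun i => 'X^(n i)) p)`_i *: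
              ('X_[rho i] : {mpoly K[e]}) =
            \sum_(m <- msupp p) p@_m *: ('X_[rho (wdeg m)] : {mpoly K[e]}).
    under eq_bigr => i _.
      rewrite /mmap coef_sum scaler_suml.
      under eq_bigr => m _ do rewrite toric_map1E coefCM coefXn.
    over.
    rewrite exchange_big [LHS]big_seq [RHS]big_seq; apply: eq_bigr => m mp.
    have ltm : (wdeg m < k)%N by rewrite ltnS; exact: leq_bigmax_seq.
    rewrite (bigD1 (Ordinal ltm)) //= eqxx mulr1 big1 ?addr0 // => i ne_i.
    by rewrite (negPf (_ : (i : nat) != wdeg m)) // mulr0 scale0r.
  move: Ip; rewrite /toric_ideal /= => ->.
  by rewrite big1 // => i _; rewrite coef0 scale0r.
have -> : p = \sum_(m <- msupp p) p@_m *: ('X_[m] - 'X_[rho (wdeg m)]).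
  under eq_bigr => m _ do rewrite scalerBr.
  by rewrite sumrB L0 subr0 -mpolyE.
rewrite big_seq.
apply: ideal_closed_sum => // m mp; rewrite -mul_mpolyC.
by apply: (ideal_closedM JI); apply: JX; rewrite wrho.
Qed.

(* [x_i |-> x_i T^(n_i)] turns the weighted grading into powers of [T]. *)
Definition wgrade : {mpoly K[e]} -> {poly {mpoly K[e]}} :=
  mmap (polyC \o mpolyC e (R := K)) (fun i => 'X_i *: 'X^(n i)).

HB.instance Definition _ := GRing.RMorphism.on wgrade.

Lemma wgradeX m : wgrade 'X_[m] = 'X_[m] *: 'X^(wdeg m).
Proof.
rewrite /wgrade mmapX /mmap1 [in RHS]mpolyXE_id /wdeg.
elim/big_rec3: _ => [|i x y z _ ->]; first by rewrite expr0 scale1r.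
by rewrite exprZn -exprM mulnC -scalerAl -scalerAr scalerA exprD.
Qed.

Lemma wgrade_whdeg d p : whdeg d p -> wgrade p = p *: 'X^d.
Proof.
move=> pd; rewrite [in RHS](mpolyE p) scaler_suml [in LHS](mpolyE p) rmorph_sum.
rewrite [LHS]big_seq [RHS]big_seq; apply: eq_bigr => m mp.
rewrite -mul_mpolyC rmorphM /= wgradeX (pd _ mp) /wgrade mmapC /= mul_polyC.
by rewrite scalerA.
Qed.

(* In the degree-[d'] component of [u = \sum c_g g] the generators of larger
   degree do not occur. *)
Lemma ideal_gen_rem gs d d' r u :
  (forall g, g \in gs -> whomog n g) -> whdeg d r -> whdeg d' u ->
  (d' < d)%N -> ideal_gen gs u -> ideal_gen (rem r gs) u.
Proof.
move=> hgs dr du lt_d [c uE].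
have -> : u = (wgrade u)`_d'.
  by rewrite (wgrade_whdeg du) coefZ coefXn eqxx mulr1.
rewrite uE rmorph_sum coef_sum /=.
apply: ideal_closed_sum; first exact: ideal_gen_closed.
move=> i _; rewrite rmorphM /=; set g := gs`_i.
have ggs : g \in gs by exact: mem_nth.
have [gr|ne_gr] := eqVneq g r.
  rewrite gr (wgrade_whdeg dr) -scalerAr coefZ coefMXn lt_d mulr0.
  exact: (ideal_closed0 (ideal_gen_closed _)).
have [dg gdg] := hgs g ggs.
rewrite (wgrade_whdeg gdg) -scalerAr coefZ coefMXn mulrC.
apply: (ideal_closedM (ideal_gen_closed _)); apply: mem_ideal_gen.
have [rgs|/rem_id -> //] := boolP (r \in gs).
by have := ggs; rewrite (perm_mem (perm_to_rem rgs)) inE (negPf ne_gr).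
Qed.

(** Each [u] has smaller degree than [r], so by homogeneity it is generated by [gs] without [r].
    Then [r] is too, against irredundancy. *)
Lemma not_minimal_generator (I : set {mpoly K[e]}) d r us :
  whdeg d r -> ideal_gen us r ->
  (forall u, u \in us -> I u /\ exists2 d', (d' < d)%N & whdeg d' u) ->
  ~ minimal_generator n I r.
Proof.
move=> dr us_r Ius [gs [[hgs IE irr] rgs]]; apply: (irr r rgs); rewrite IE.
apply: eq_ideal_gen => g; first by move/mem_rem; exact: mem_ideal_gen.
have [-> _|ne_gr ggs] := eqVneq g r; last first.
  apply: mem_ideal_gen; have := ggs.
  by rewrite (perm_mem (perm_to_rem rgs)) inE (negPf ne_gr).
apply: ideal_gen_min us_r; first exact: ideal_gen_closed.
move=> u /Ius[Iu [d' lt_d du]]; apply: (ideal_gen_rem hgs dr du lt_d).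
by rewrite -IE.
Qed.

End WeightedDegree.

(** Exponents with disjoint supports are determined by their difference, as its positive and
    negative parts. *)
Lemma RF_binomialE (e : nat) (K : fieldType) (A : 'M[int]_e) i j
    (u v : 'X_{1..e}) :
  (forall k, A i k - A j k = (u k)%:Z - (v k)%:Z) ->
  (forall k, u k = 0%N \/ v k = 0%N) ->
  RF_binomial K A i j = 'X_[u] - 'X_[v].
Proof.
move=> Auv uv0; rewrite /RF_binomial.
have posE : pos_part (row i A - row j A) = u.
  by apply/mnmP => k; rewrite mnmE !mxE; have := Auv k; have := uv0 k; lia.
congr ('X_[_] - 'X_[_]) => //.
by apply/mnmP => k; rewrite mnmE posE !mxE; have := Auv k; have := uv0 k; lia.
Qed.

(** * Gaps, the Frobenius number, and minimal generators *)

Section Semigroup.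
Variable H : set nat.
Hypothesis semigroupH : numerical_semigroup H.

Lemma mem_gaps x : (x \in gaps H) = `[< ~ H x >].
Proof.
have [_ _ finH _] := semigroupH; rewrite /gaps in_fset_set //.
Qed.

Lemma gt_Frobenius x : (Frobenius H < x)%N -> H x.
Proof.
move=> ltx; apply: contrapT => Hx; suff: (x <= Frobenius H)%N by lia.
by apply: leq_bigmax_seq => //; rewrite mem_gaps; exact/asboolP.
Qed.

Lemma Frobenius_gap : ~ H (Frobenius H).
Proof.
have [_ _ _ HT] := semigroupH; suff: Frobenius H \in gaps H.
  by rewrite mem_gaps => /asboolP.
have [x xgap] : exists x, x \in gaps H.
  apply: contrapT => nogap; apply: HT; apply/seteqP; split=> // x _.
  apply: contrapT => Hx; apply: nogap; exists x.
  by rewrite mem_gaps; exact/asboolP.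
(* The maximum of an empty sequence is 0 by convention, so it is attained only once a gap is known
   to exist; [H <> setT] provides one. *)
suff max_mem (s : seq nat) : s != [::] -> \max_(y <- s) y \in s.
  apply: (max_mem (enum_fset (gaps H))); apply: contraTneq xgap => s0.
  by rewrite -[_ \in _]/(x \in enum_fset (gaps H)) s0.
elim: s => // y s IHs _; rewrite big_cons inE.
case: (s =P [::]) => [->|/eqP /IHs]; first by rewrite big_nil maxn0 eqxx.
by case: leqP => _ H1; rewrite ?H1 ?eqxx ?orbT.
Qed.

Lemma card_gaps :
  #|` gaps H| = (\sum_(x < (Frobenius H).+1) `[< ~ H x >])%N.
Proof.
rewrite -(big_mkord xpredT (fun x => `[< ~ H x >] : nat)) -sum1_size.
rewrite (perm_big [seq x <- index_iota 0 (Frobenius H).+1 | `[< ~ H x >]]).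
  by rewrite big_filter big_mkcond; apply: eq_bigr => i _; case: asboolP.
apply: uniq_perm; rewrite ?fset_uniq ?filter_uniq ?iota_uniq // => x.
rewrite [LHS]mem_gaps mem_filter mem_index_iota leq0n ltnS /=.
case: asboolP => //= Hx; apply/esym; rewrite leqNgt; apply/negP.
by move/gt_Frobenius.
Qed.

(** Among [x] and [F - x] exactly one is a gap, except at [x = f], where both are the same gap.
    Summing over [0 <= x <= F] counts each gap twice and gives [(F + 1) + 1]. *)
Lemma symmetric_gaps (f : nat) :
  Frobenius H = (f * 2)%N -> ~ H f ->
  (forall x, (x <= Frobenius H)%N -> ~ H x -> x <> f ->
     H (Frobenius H - x)%N) ->
  (2 * #|` gaps H| = Frobenius H + 2)%N.
Proof.
move=> FE Hf sym; have [_ HD _ _] := semigroupH.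
have E (x : 'I_(Frobenius H).+1) :
  (`[< ~ H x >] + `[< ~ H (Frobenius H - x) >] = 1 + (x == inord f))%N.
  have lex : (x <= Frobenius H)%N by rewrite -ltnS.
  have -> : (x == inord f) = (x == f :> nat).
    by rewrite -val_eqE /= inordK //; lia.
  have [Hx|Hx] := asboolP (~ H x); last first.
    rewrite asboolT; first by case: eqP Hx => // ->.
    move=> Hx'; apply: Frobenius_gap; rewrite -(subnKC lex); apply: HD => //.
    exact: contrapT.
  have [xf|xf] := eqVneq (x : nat) f.
    by rewrite xf asboolT // FE (_ : f * 2 - f = f)%N //; lia.
  by rewrite asboolF // => Hx'; apply: Hx'; apply: sym => //; exact/eqP.
have := eq_bigr (P := xpredT) (op := addn) (idx := 0%N)
  (r := index_enum 'I_(Frobenius H).+1) _ (fun x _ => E x).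
rewrite !big_split -card_gaps /= sum1_card card_ord.
have -> : (\sum_(x < (Frobenius H).+1) (x == inord f) = 1)%N.
  by rewrite (bigD1 (inord f)) //= eqxx big1 // => x /negPf ->.
rewrite [X in _ + X = _](_ : _ = #|` gaps H|)%N.
  by rewrite mul2n -addnn addn1 addn2.
rewrite card_gaps [RHS](reindex_inj rev_ord_inj) /=.
by apply: eq_bigr => x _; rewrite subSS.
Qed.

Variables (e : nat) (n : 'I_e -> nat).
Hypothesis minimalH : minimally_generated H n.

Lemma mem_semigroup h :
  H h <-> exists m : 'X_{1..e}, h = wdeg n m.
Proof.
have [-> _] := minimalH; split=> [[c ->]|[m ->]].
  exists [multinom c i | i < e].
  by rewrite /wdeg; apply: eq_big => [i|i _]; rewrite ?inE ?mnmE.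
by exists m; apply: eq_bigl => i; rewrite inE.
Qed.

(** Otherwise [n i] could be substituted away in every factorization, and the remaining generators
    would span [H]. *)
Lemma minimal_generator_neq i (m : 'X_{1..e}) :
  m i = 0%N -> n i <> wdeg n m.
Proof.
move=> mi0 niE; have [HE minH] := minimalH.
have proper_i : ([set~ i] \proper [set: 'I_e])%SET.
  by rewrite properT; apply/eqP => /setP/(_ i); rewrite !inE eqxx.
apply: (minH _ proper_i); rewrite HE; apply/seteqP; split=> h [c ->].
  exists (fun j => if j == i then 0%N else c j).
  rewrite [RHS](bigD1 i) ?inE //= eqxx mul0n add0n.
  by apply: eq_big => [j|j]; rewrite !inE // => /negPf ->.
exists (fun j => c j + c i * m j)%N; rewrite (bigD1 i) ?inE //= niE.
under [RHS]eq_bigr => j _ do rewrite mulnDl -mulnA.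
rewrite big_split /= -big_distrr /= /wdeg [in LHS](bigD1 i) //= mi0 add0n.
by rewrite addnC; congr (_ + _ * _)%N; apply: eq_bigl => j; rewrite !inE.
Qed.

End Semigroup.

(** * Monomials in four variables *)

Section FourVariables.

Lemma ord4P (i : 'I_4) : [\/ i = i1, i = i2, i = i3 | i = i4].
Proof.
by case: i => [[|[|[|[|//]]]] lti];
  [apply: Or41|apply: Or42|apply: Or43|apply: Or44]; apply: val_inj.
Qed.

Lemma big_ord4 (R : Type) (idx : R) (op : Monoid.law idx) (F : 'I_4 -> R) :
  \big[op/idx]_i F i = op (op (op (F i1) (F i2)) (F i3)) (F i4).
Proof.
rewrite !big_ord_recr big_ord0 /= Monoid.mul1m.
by congr (op (op (op (F _) (F _)) (F _)) (F _)); apply: val_inj.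
Qed.

Definition mon4 (c1 c2 c3 c4 : nat) : 'X_{1..4} :=
  [multinom nth 0%N [:: c1; c2; c3; c4] i | i < 4].

Lemma mon4_eta (m : 'X_{1..4}) : m = mon4 (m i1) (m i2) (m i3) (m i4).
Proof. by apply/mnmP => i; rewrite mnmE; case: (ord4P i) => ->. Qed.

Lemma mon4D c1 c2 c3 c4 d1 d2 d3 d4 :
  mon4 (c1 + d1) (c2 + d2) (c3 + d3) (c4 + d4) =
  (mon4 c1 c2 c3 c4 + mon4 d1 d2 d3 d4)%MM.
Proof. by apply/mnmP => i; rewrite !mnmE; case: (ord4P i) => ->. Qed.

Lemma mpolyX_mon4 (R : comNzRingType) c1 c2 c3 c4 :
  'X_[mon4 c1 c2 c3 c4] =
  'X_i1 ^+ c1 * 'X_i2 ^+ c2 * 'X_i3 ^+ c3 * 'X_i4 ^+ c4 :> {mpoly R[4]}.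
Proof. by rewrite mpolyXE_id big_ord4 !mnmE. Qed.

End FourVariables.

(** * The Apery set of [n2], its cardinality and its symmetry *)

Section FourGenerators.
Local Open Scope nat_scope.

(* With the notation of the theorem, [p = a1 - 1], [q = a3 - 2], [r = a4 - 1],
   [s = a42] and [b = a2 - 1 - a42]; the four equations are the rows of the
   matrix. *)
Variables (H : set nat) (n : 'I_4 -> nat) (f p q r s b : nat).
Local Notation n1 := (n i1).
Local Notation n2 := (n i2).
Local Notation n3 := (n i3).
Local Notation n4 := (n i4).

Definition val4 c1 c2 c3 c4 := c1 * n1 + c2 * n2 + c3 * n3 + c4 * n4.

Hypotheses (memH : forall h, H h <-> exists c1 c2 c3 c4, h = val4 c1 c2 c3 c4)
  (n_gt0 : forall i, 0 < n i)
  (s_gt0 : 0 < s) (b_gt0 : 0 < b)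
  (row1 : f + n1 = (s + b) * n2) (row2 : f + n2 = q.+1 * n3)
  (row3 : f + n3 = p * n1 + r * n4) (row4 : f + n4 = p * n1 + s * n2)
  (Hf : ~ H f) (HF : ~ H (f * 2)) (Hgt : forall x, f * 2 < x -> H x).

(* Exponents of the monomials outside the initial ideal: those with no factor
   [x1^p.+1], [x1 x3^q.+1], [x3^q.+2], [x3^q.+1 x4] or [x4^r.+1]. *)
Definition normal c1 c3 c4 :=
  [&& c1 <= p, c3 <= q & c4 <= r] || [&& c1 == 0, c3 == q.+1 & c4 == 0].

Lemma memH_val4 c1 c2 c3 c4 : H (val4 c1 c2 c3 c4).
Proof. by apply/memH; exists c1, c2, c3, c4. Qed.

Lemma memH_add x y : H x -> H y -> H (x + y).
Proof.
move=> /memH[c1 [c2 [c3 [c4 ->]]]] /memH[d1 [d2 [d3 [d4 ->]]]].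
apply/memH; exists (c1 + d1), (c2 + d2), (c3 + d3), (c4 + d4).
by rewrite /val4; ring.
Qed.

(** These five relations are differences of two rows: 1 and 4, 2 and 3, 3 and 4, 1 and 2, 2 and 4,
    in this order. *)
Lemma rel1 : p.+1 * n1 = b * n2 + n4. Proof. lia. Qed.
Lemma rel3 : q.+2 * n3 = p * n1 + n2 + r * n4. Proof. lia. Qed.
Lemma rel4 : r.+1 * n4 = s * n2 + n3. Proof. lia. Qed.
Lemma rel13 : n1 + q.+1 * n3 = (s + b).+1 * n2. Proof. lia. Qed.
Lemma rel34 : q.+1 * n3 + n4 = p * n1 + s.+1 * n2. Proof. lia. Qed.
(** Rows 2 and 3 added, with one [n3] cancelled. *)
Lemma top_row : f * 2 + n2 = val4 p 0 q r. Proof. rewrite /val4; lia. Qed.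

(** A monomial that is not normal is rewritten by one of the five relations into one divisible by
    [x2], so that [n2] can be subtracted within [H]. Positivity of [b] and [s] ensures the factor
    [x2] in [rel1] and [rel4]. *)
Lemma normal_apery c1 c2 c3 c4 :
  (forall g, H g -> val4 c1 c2 c3 c4 <> g + n2) ->
  c2 = 0 /\ normal c1 c3 c4.
Proof.
move=> ap.
have noapp d1 d2 d3 d4 :
    val4 c1 c2 c3 c4 = val4 d1 d2.+1 d3 d4 -> False.
  move=> E; apply: (ap (val4 d1 d2 d3 d4)); first exact: memH_val4.
  by rewrite E /val4; ring.
have c2_0 : c2 = 0.
  case: c2 => // c2 in ap noapp *; by case: (noapp c1 c2 c3 c4).
split=> //; rewrite c2_0 in noapp.
have le1 : c1 <= p.
  rewrite leqNgt; apply/negP => lt1; apply: (noapp (c1 - p.+1) b.-1 c3 c4.+1).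
  have := rel1; rewrite -{1}(subnK lt1) /val4 (prednK b_gt0); lia.
have le3 : c3 <= q.+1.
  rewrite leqNgt; apply/negP => lt3.
  apply: (noapp (c1 + p) 0 (c3 - q.+2) (c4 + r)).
  have := rel3; rewrite -{1}(subnK lt3) /val4; lia.
have le4 : c4 <= r.
  rewrite leqNgt; apply/negP => lt4; apply: (noapp c1 s.-1 c3.+1 (c4 - r.+1)).
  have := rel4; rewrite -{1}(subnK lt4) /val4 (prednK s_gt0); lia.
rewrite /normal; have [le3'|lt3] := leqP c3 q; first by rewrite le1 le4.
have c3E : c3 = q.+1 by lia.
case: c1 => [|c1] in noapp le1 ap *; last first.
  case: (noapp c1 (s + b) 0 c4); have := rel13; rewrite c3E /val4; lia.
case: c4 => [|c4] in noapp le4 ap *; last first.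
  case: (noapp p s 0 c4); have := rel34; rewrite c3E /val4; lia.
by rewrite c3E !eqxx orbT.
Qed.

(** Since [f * 2] is a gap, [normal_apery] applies. Either the monomial divides the top one and has
    the same value, or it is [x3^(q+1)], of value [f + n2], which forces [f = 0]. *)
Lemma top_unique c1 c2 c3 c4 :
  f * 2 + n2 = val4 c1 c2 c3 c4 -> [/\ c1 = p, c2 = 0, c3 = q & c4 = r].
Proof.
move=> E; have [|c2_0 /orP[/and3P[le1 le3 le4]|]] := @normal_apery c1 c2 c3 c4.
- by move=> g Hg; rewrite -E => /addIn gE; apply: HF; rewrite gE.
- move: E; rewrite top_row c2_0 /val4 => E.
  (* Each term is at most the corresponding term of the top monomial, so equal sums force equal
     terms. *)
  have := leq_mul2r n1 c1 p; have := leq_mul2r n3 c3 q.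
  have := leq_mul2r n4 c4 r.
  rewrite le1 le3 le4 !orbT => M4 M3 M1.
  by split=> //; apply/eqP;
    [rewrite -(eqn_pmul2r (n_gt0 i1))|rewrite -(eqn_pmul2r (n_gt0 i3))
    |rewrite -(eqn_pmul2r (n_gt0 i4))]; apply/eqP; lia.
case/and3P=> /eqP c1E /eqP c3E /eqP c4E.
case: Hf; apply/memH; exists 0, 0, 0, 0.
move: E row2; rewrite c1E c2_0 c3E c4E /val4; lia.
Qed.

(** After [x2^c2] is cancelled, multiplying by the cofactor that completes the [c] monomial to the
    top one yields another factorization of [f * 2 + n2], to which [top_unique] applies. *)
Lemma normal_inj c1 c2 c3 c4 d1 d2 d3 d4 :
  normal c1 c3 c4 -> normal d1 d3 d4 ->
  val4 c1 c2 c3 c4 = val4 d1 d2 d3 d4 ->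
  [/\ c1 = d1, c2 = d2, c3 = d3 & c4 = d4].
Proof.
wlog le2 : c1 c2 c3 c4 d1 d2 d3 d4 / c2 <= d2.
  move=> W Nc Nd E; have [le2|/ltnW le2] := leqP c2 d2; first exact: W.
  by have [-> -> -> ->] := W _ _ _ _ _ _ _ _ le2 Nd Nc (esym E).
move=> Nc Nd E.
case/orP: Nc => [/and3P[le1 le3 le4]|/and3P[/eqP c1E /eqP c3E /eqP c4E]].
  have := @top_unique (p - c1 + d1) (d2 - c2) (q - c3 + d3) (r - c4 + d4).
  rewrite top_row; case=> [|e1 e2 e3 e4]; last by split; lia.
  move: E; rewrite -{1}(subnK le1) -{1}(subnK le2) -{1}(subnK le3).
  rewrite -{1}(subnK le4).
  by rewrite /val4; lia.
(* Now the [c] monomial is [x2^c2 x3^(q+1)]. Against a divisor of the top monomial, [c2 = d2] would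
   give a factorization of [f * 2 + n2] with [x3] exponent above [q], and [c2 < d2] would put [f] in
   [H]. *)
case/orP: Nd => [/and3P[le1 le3 le4]|/and3P[/eqP d1E /eqP d3E /eqP d4E]].
  have := @top_unique (p - d1) 0 (q - d3 + q.+1) (r - d4).
  have [e2|ne2] := eqVneq c2 d2.
    rewrite top_row; case=> [|_ _]; last by lia.
    move: E; rewrite c1E c3E c4E e2 -{1}(subnK le1) -{1}(subnK le3).
    rewrite -{1}(subnK le4).
    by rewrite /val4; lia.
  case: Hf; rewrite (_ : f = val4 d1 (d2 - c2).-1 d3 d4).
    exact: memH_val4.
  have [k d2E] : exists k, d2 = c2 + k.+1 by exists (d2 - c2).-1; lia.
  move: E row2; rewrite c1E c3E c4E d2E addKn /val4; lia.
suff: c2 = d2 by split; lia.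
apply/eqP; rewrite -(eqn_pmul2r (n_gt0 i2)).
by move: E; rewrite c1E c3E c4E d1E d3E d4E /val4; lia.
Qed.

(** The least [k] with [x + k * n2] in [H] gives an Apery element: for [k > 0] by minimality, and
    for [k = 0] because then [x < n2]. *)
Lemma apery_exists x : (x < n2 \/ ~ H x) ->
  exists k c1 c3 c4, normal c1 c3 c4 /\ x + k * n2 = val4 c1 0 c3 c4.
Proof.
move=> Hx; have exk : exists k, `[< H (x + k * n2) >].
  exists (f * 2).+1; apply/asboolP; apply: Hgt.
  exact: leq_trans (leq_pmulr _ (n_gt0 i2)) (leq_addl _ _).
have [k /asboolP Hk min_k] := find_ex_minn exk.
have [c1 [c2 [c3 [c4 E]]]] := (memH _).1 Hk.
have [|c2_0 Nc] := @normal_apery c1 c2 c3 c4.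
  move=> g Hg; rewrite -E; case: k => [|k] in Hk min_k E *.
    by case: Hx => [|[]]; [lia|rewrite mul0n addn0 in Hk].
  move=> gE; suff /asboolP/min_k : H (x + k * n2) by lia.
  by rewrite (_ : x + k * n2 = g) //; lia.
by exists k, c1, c3, c4; rewrite E c2_0.
Qed.

(** The divisors of the top monomial are permuted by taking cofactors; only [x3^(q+1)] lies outside
    this symmetry. *)
Lemma normal_cases c1 c3 c4 : normal c1 c3 c4 ->
  val4 c1 0 c3 c4 = f + n2 \/
  val4 c1 0 c3 c4 + val4 (p - c1) 0 (q - c3) (r - c4) = f * 2 + n2.
Proof.
case/orP => [/and3P[le1 le3 le4]|/and3P[/eqP -> /eqP -> /eqP ->]]; last first.
  by left; rewrite row2 /val4; lia.
right; rewrite top_row -{2}(subnK le1) -{2}(subnK le3) -{2}(subnK le4).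
by rewrite /val4; lia.
Qed.

(** With [x + k * n2] in the Apery set and [k > 0], its cofactor plus [(k - 1) * n2] has value
    [f * 2 - x]. If the Apery element is [f + n2], then [k = 1] means [x = f], and a larger [k]
    leaves [f + n2] plus a multiple of [n2]. *)
Lemma gap_symmetric x : x <= f * 2 -> ~ H x -> x <> f -> H (f * 2 - x).
Proof.
move=> lex Hx xf; have [k [c1 [c3 [c4 [Nc E]]]]] := apery_exists (or_intror Hx).
case: k E => [|k] E.
  by case: Hx; rewrite -[x]addn0 -(mul0n n2) E; exact: memH_val4.
case: (normal_cases Nc) => E'.
  case: k E => [|k] E; first by lia.
  rewrite (_ : f * 2 - x = k * n2 + (f + n2)); last by lia.
  rewrite row2 (_ : _ + _ = val4 0 k q.+1 0); first exact: memH_val4.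
  by rewrite /val4; lia.
rewrite (_ : _ - _ = val4 (p - c1) k (q - c3) (r - c4)); first exact: memH_val4.
by move: E'; rewrite -E /val4; lia.
Qed.

(** Normal monomials without [x2] represent each residue modulo [n2] exactly once. In [T], [None]
    stands for [x3^(q+1)]. *)
Lemma apery_card : n2 = p.+1 * r.+1 * q.+1 + 1.
Proof.
pose T := option ('I_p.+1 * 'I_q.+1 * 'I_r.+1).
pose c (t : T) : nat * nat * nat :=
  if t is Some (c1, c3, c4) then (val c1, val c3, val c4) else (0, q.+1, 0).
pose v t := val4 (c t).1.1 0 (c t).1.2 (c t).2.
have normal_c t : normal (c t).1.1 (c t).1.2 (c t).2.
  case: t => [[[c1 c3] c4]|] /=; last by rewrite /normal !eqxx orbT.
  by rewrite /normal !leq_ord.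
have c_surj c1 c3 c4 : normal c1 c3 c4 -> exists t, c t = (c1, c3, c4).
  case/orP => [/and3P[le1 le3 le4]|/and3P[/eqP -> /eqP -> /eqP ->]].
    by exists (Some (inord c1, inord c3, inord c4)); rewrite /= !inordK.
  by exists None.
have c_inj : injective c.
  move=> [[[c1 c3] c4]|] [[[d1 d3] d4]|] //= [].
  - by move=> /val_inj -> /val_inj -> /val_inj ->.
  - by move=> _ E; have := ltn_ord c3; rewrite E ltnn.
  - by move=> _ E; have := ltn_ord d3; rewrite -E ltnn.
pose residue t := Ordinal (ltn_pmod (v t) (n_gt0 i2)).
have residue_inj : injective residue.
  move=> t t' /(congr1 val) /= E; apply: c_inj.
  (* Values with the same residue become equal once each receives the other's quotient as exponent
     of [x2]. *)
  have [] := @normal_inj _ (v t' %/ n2) _ _ _ (v t %/ n2) _ _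
    (normal_c t) (normal_c t').
    have := divn_eq (v t) n2; have := divn_eq (v t') n2.
    by rewrite E {1 4}/v /val4; lia.
  by case: (c t) (c t') => [[? ?] ?] [[? ?] ?] /= -> _ -> ->.
have card_T : #|{: T}| = p.+1 * r.+1 * q.+1 + 1.
  by rewrite card_option !card_prod !card_ord addn1 mulnAC.
rewrite -card_T -(card_codom residue_inj) -[LHS]card_ord.
apply: eq_card => i; rewrite [LHS]inE; apply/esym/codomP.
have [k [c1 [c3 [c4 [Nc E]]]]] := apery_exists (or_introl (ltn_ord i)).
have [t ct] := c_surj _ _ _ Nc; exists t; apply: val_inj.
by rewrite /= /v ct -E addnC modnMDl modn_small.
Qed.



Lemma wdeg_mon4 c1 c2 c3 c4 : wdeg n (mon4 c1 c2 c3 c4) = val4 c1 c2 c3 c4.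
Proof. by rewrite /wdeg big_ord4 !mnmE. Qed.

Lemma f_gt0 : 0 < f.
Proof.
rewrite lt0n; apply: contra_not_neq Hf => ->.
by apply/memH; exists 0, 0, 0, 0.
Qed.

Lemma top_unique_factorization : unique_factorization n (f * 2 + n2).
Proof.
exists [ffun i : 'I_4 => nth 0 [:: p; 0; q; r] i].
split=> [|c]; rewrite big_ord4; first by rewrite !ffunE top_row.
by move/top_unique=> [c1 c2 c3 c4]; apply/ffunP => i; rewrite ffunE;
  case: (ord4P i) => ->.
Qed.

(** For [g] pseudo-Frobenius, [g + n2] is an Apery element. If it is not [f + n2] and its cofactor
    is divisible by some [x_i], then [g + n i] in [H] makes [f * 2] an element of [H]; so the
    cofactor is 1 and [g = f * 2]. *)
Lemma PF_eq : PF H n f -> PF H n = [set f%:Z; (f * 2)%:Z]%classic.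
Proof.
move=> PFf; apply/seteqP; split=> [g [Hg PFg]|_ [->|->]] //=; last first.
  split=> [[x Hx [xE]]|i]; first by apply: HF; rewrite -xE.
  by exists (f * 2 + n i) => //; apply: Hgt; have := n_gt0 i; lia.
have [h Hh hE] := PFg i2; have [c1 [c2 [c3 [c4 hc]]]] := (memH _).1 Hh.
have [|c2_0 Nc] := @normal_apery c1 c2 c3 c4.
  by move=> x Hx; rewrite -hc => hx; apply: Hg; exists x => //; lia.
rewrite c2_0 in hc; case: (normal_cases Nc); rewrite -hc => E.
  by left; move: hE; rewrite E; lia.
have [c0|/existsP[i ci]] :=
  boolP [forall i, mon4 (p - c1) 0 (q - c3) (r - c4) i == 0].
  right; move: E; rewrite -wdeg_mon4 /wdeg big1 ?addn0; first by lia.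
  by move=> i _; move/forallP/(_ i)/eqP: c0 => ->.
pose m := (mon4 (p - c1) 0 (q - c3) (r - c4) - U_(i))%MM.
have mE : wdeg n m + n i = val4 (p - c1) 0 (q - c3) (r - c4).
  by rewrite -wdeg_mon4 -(wdegU n i) -wdegD submK // lep1mP.
have [x Hx xE] := PFg i; case: HF.
rewrite (_ : f * 2 = x + wdeg n m); last by move: E; rewrite -mE; lia.
by apply: memH_add => //; rewrite (mon4_eta m) wdeg_mon4; exact: memH_val4.
Qed.

Lemma sgtype_eq2 : PF H n f -> sgtype H n = 2.
Proof.
move=> PFf; rewrite /sgtype PF_eq //.
rewrite fset_setU ?fset_set1; try exact: finite_set1.
rewrite cardfs2; case: eqP => // - [E]; have := f_gt0; lia.
Qed.

(** * Normal forms modulo the five binomials, and generators of the toric ideal *)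

Section ToricIdeal.
Variable K : fieldType.
Implicit Type J : set {mpoly K[4]}.
Local Open Scope ring_scope.

(* Rewriting the first monomial into the second raises the exponent of [x2]. *)
Definition binomials4 : seq ('X_{1..4} * 'X_{1..4}) :=
  [:: (mon4 1 0 q.+1 0, mon4 0 (s + b).+1 0 0);
      (mon4 p.+1 0 0 0, mon4 0 b 0 1);
      (mon4 0 0 q.+2 0, mon4 p 1 0 r);
      (mon4 0 0 q.+1 1, mon4 p s.+1 0 0);
      (mon4 0 0 0 r.+1, mon4 0 s 1 0)].

Lemma binomials4_wdeg m : m \in binomials4 -> wdeg n m.1 = wdeg n m.2.
Proof.
by rewrite !inE => /or4P[/eqP->|/eqP->|/eqP->|/orP[/eqP->|/eqP->]] /=;
  rewrite !wdeg_mon4 /val4; have := (rel1, rel3, rel4, rel13, rel34);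
  case=> [] [] [] [] *; lia.
Qed.

Lemma binomials4_reduce c1 c2 c3 c4 : ~~ normal c1 c3 c4 ->
  exists m u, m \in binomials4 /\ mon4 c1 c2 c3 c4 = (u + m.1)%MM.
Proof.
rewrite /normal => abnormal.
have /or4P : [|| p < c1, q.+1 < c3, r < c4 |
    (0 < c1) && (q < c3) || (q < c3) && (0 < c4)]%N by lia.
case=> [lt1|lt3|lt4|/orP[/andP[lt1 lt3]|/andP[lt3 lt4]]].
- exists (mon4 p.+1 0 0 0, mon4 0 b 0 1), (mon4 (c1 - p.+1) c2 c3 c4).
  by rewrite !inE !eqxx ?orbT; split=> //; rewrite -mon4D; congr mon4; lia.
- exists (mon4 0 0 q.+2 0, mon4 p 1 0 r), (mon4 c1 c2 (c3 - q.+2) c4).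
  by rewrite !inE !eqxx ?orbT; split=> //; rewrite -mon4D; congr mon4; lia.
- exists (mon4 0 0 0 r.+1, mon4 0 s 1 0), (mon4 c1 c2 c3 (c4 - r.+1)).
  by rewrite !inE !eqxx ?orbT; split=> //; rewrite -mon4D; congr mon4; lia.
- exists (mon4 1 0 q.+1 0, mon4 0 (s + b).+1 0 0),
    (mon4 c1.-1 c2 (c3 - q.+1) c4).
  by rewrite !inE !eqxx ?orbT; split=> //; rewrite -mon4D; congr mon4; lia.
- exists (mon4 0 0 q.+1 1, mon4 p s.+1 0 0), (mon4 c1 c2 (c3 - q.+1) c4.-1).
  by rewrite !inE !eqxx ?orbT; split=> //; rewrite -mon4D; congr mon4; lia.
Qed.

Lemma binomials4_normal J m : ideal_closed J ->
  (forall m', m' \in binomials4 -> J ('X_[m'.1] - 'X_[m'.2])) ->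
  exists c1 c2 c3 c4, [/\ normal c1 c3 c4, wdeg n m = val4 c1 c2 c3 c4 &
    J ('X_[m] - 'X_[mon4 c1 c2 c3 c4])].
Proof.
(* Termination: rewriting keeps the weight, which bounds the exponent of [x2], and raises that
   exponent. *)
move=> JI Jb; have [k] := ubnP (wdeg n m - m i2); elim: k m => // k IHk m lt_k.
have le_m (m' : 'X_{1..4}) : (m' i2 <= wdeg n m')%N.
  rewrite {2}(mon4_eta m') wdeg_mon4 /val4.
  by have := leq_pmulr (m' i2) (n_gt0 i2); lia.
have [Nm|/(binomials4_reduce (m i2))] := boolP (normal (m i1) (m i3) (m i4)).
  exists (m i1), (m i2), (m i3), (m i4).
  rewrite -wdeg_mon4 -mon4_eta subrr; split=> //; exact: ideal_closed0 JI.
rewrite -mon4_eta => -[m' [u [m'b mE]]]; pose v := (u + m'.2)%MM.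
have vm : wdeg n v = wdeg n m by rewrite mE !wdegD (binomials4_wdeg m'b).
have ltv : (m i2 < v i2)%N.
  rewrite mE !mnmDE ltn_add2l.
  move: m'b; rewrite !inE => /or4P[/eqP->|/eqP->|/eqP->|/orP[/eqP->|/eqP->]];
    by rewrite /= !mnmE /=.
have [|c1 [c2 [c3 [c4 [Nc cE Jc]]]]] := IHk v.
  by have := le_m v; lia.
exists c1, c2, c3, c4; split=> //; first by rewrite -vm.
rewrite -(subrKA 'X_[v]); apply: (ideal_closedD JI) => //.
rewrite mE !mpolyXD -mulrBr; apply: (ideal_closedM JI); exact: Jb.
Qed.

(** Monomials of equal weight have normal forms of equal weight, which coincide by [normal_inj]. *)
Lemma toric_ideal4 (gs : seq {mpoly K[4]}) :
  (forall m, m \in binomials4 -> ideal_gen gs ('X_[m.1] - 'X_[m.2])) ->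
  (forall g, g \in gs -> toric_ideal K n g) ->
  toric_ideal K n = ideal_gen gs.
Proof.
move=> Jb gsI; apply/seteqP; split; last first.
  by apply: ideal_gen_min => //; exact: toric_ideal_closed.
have JI := ideal_gen_closed gs.
apply: toric_ideal_min => // m m' mm'.
have [c1 [c2 [c3 [c4 [Nc cE Jc]]]]] := binomials4_normal m JI Jb.
have [d1 [d2 [d3 [d4 [Nd dE Jd]]]]] := binomials4_normal m' JI Jb.
have [] := @normal_inj c1 c2 c3 c4 d1 d2 d3 d4 Nc Nd.
  by rewrite -cE -dE.
move=> e1 e2 e3 e4; rewrite -e1 -e2 -e3 -e4 in Jd.
by have := ideal_closedB JI Jc Jd; rewrite opprB addrA subrK.
Qed.

End ToricIdeal.
End FourGenerators.

(** * From the matrix to the four row equations, the RF-relations and the three conclusions *)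

Theorem theorem4p4 (K : fieldType) (H : set nat) (n : 'I_4 -> nat)
  (a1 a2 a3 a4 a42 : nat) (f : int) :
  numerical_semigroup H ->
  minimally_generated H n ->
  f *+ 2 = (Frobenius H)%:Z ->
  PF H n f ->
  is_alpha n i1 a1 -> is_alpha n i2 a2 ->
  is_alpha n i3 a3 -> is_alpha n i4 a4 ->
  let A := matrix4
    [:: [::          -1; a2%:Z - 1;         0;         0];
        [::           0;        -1; a3%:Z - 1;         0];
        [::   a1%:Z - 1;         0;        -1; a4%:Z - 1];
        [::   a1%:Z - 1;    a42%:Z;         0;        -1]] in
  RF_matrix H n f A ->
  let x1 : {mpoly K[4]} := 'X_i1 in
  let x2 : {mpoly K[4]} := 'X_i2 in
  let x3 : {mpoly K[4]} := 'X_i3 in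
  let x4 : {mpoly K[4]} := 'X_i4 in
  let gens : seq {mpoly K[4]} :=
    [:: x2 ^+ a2 - x1 * x3 ^+ (a3 - 1);
        x1 ^+ a1 - x2 ^+ (a2 - 1 - a42) * x4;
        x3 ^+ a3 - x1 ^+ (a1 - 1) * x2 * x4 ^+ (a4 - 1);
        x3 ^+ (a3 - 1) * x4 - x1 ^+ (a1 - 1) * x2 ^+ (a42 + 1);
        x4 ^+ a4 - x2 ^+ a42 * x3] in
  [/\ unique_factorization n (Frobenius H + n i2)%N /\
      n i2 = (a1 * a4 * (a3 - 1) + 1)%N,
      [/\ generated_by_RF_relations H n f (toric_ideal K n),
          (a42 <= a2 - 1)%N,
          toric_ideal K n = ideal_gen gens,
          (forall g, g \in gens ->
             exists i j : 'I_4, (i < j)%N /\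
               (g = RF_binomial K A i j \/ g = - RF_binomial K A i j)) &
          ~ minimal_generator n (toric_ideal K n) (RF_binomial K A i1 i3)] &
      almost_symmetric H n /\ sgtype H n = 2%N].
Proof.
move=> Hsg Hmin fF PFf [a1_gt0 _ _] [a2_gt0 _ _] [a3_gt0 _ _] [a4_gt0 _ _].
move=> A rfA x1 x2 x3 x4 gens.
have [_ _ _ rowA] := rfA.
have {rowA} := (rowA i1, rowA i2, rowA i3, rowA i4).
rewrite !big_ord4 !mxE /= => -[[[row1 row2] row3] row4].
have n_gt0 i : (0 < n i)%N.
  rewrite lt0n; apply/eqP => ni0.
  apply: (minimal_generator_neq Hmin (i := i) (m := 0%MM)); rewrite ?mnm0E //.
  by rewrite ni0 /wdeg big1 // => j _; rewrite mnm0E.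
have minn i c1 c2 c3 c4 : mon4 c1 c2 c3 c4 i = 0%N -> n i <> val4 n c1 c2 c3 c4.
  by rewrite -wdeg_mon4; exact: (minimal_generator_neq Hmin).
have memH h : H h <-> exists c1 c2 c3 c4, h = val4 n c1 c2 c3 c4.
  rewrite (mem_semigroup Hmin); split=> [[m ->]|[c1 [c2 [c3 [c4 ->]]]]].
    by exists (m i1), (m i2), (m i3), (m i4); rewrite -wdeg_mon4 -mon4_eta.
  by exists (mon4 c1 c2 c3 c4); rewrite wdeg_mon4.
case: f fF PFf rfA row1 row2 row3 row4 => [f|f] fF PFf rfA row1 row2 row3 row4;
  last by lia.
have FE : Frobenius H = (f * 2)%N by lia.
have HF : ~ H (f * 2)%N by rewrite -FE; exact: Frobenius_gap.
have Hgt x : (f * 2 < x)%N -> H x by rewrite -FE; exact: gt_Frobenius.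
have Hf : ~ H f by move=> Hf; case: PFf => + _; apply; exists f.
(* The value [a3 = 1] is excluded because row 2 would then give [f = - n2 < 0]. *)
case: a1 a2 a3 a4 a1_gt0 a2_gt0 a3_gt0 a4_gt0
    => [//|p] [//|t] [//|[|q]] [//|r] _ _ _ _
    in A gens rfA row1 row2 row3 row4 *.
  by have := n_gt0 i2; lia.
(* Failure of any of the next three inequalities contradicts minimality: [r = 0] gives
   [n4 = a42 n2 + n3], [a42 = 0] gives [n3 = (r+1) n4], and [t <= a42] gives
   [n4 = (p+1) n1 + (a42 - t) n2]. *)
have r_gt0 : (0 < r)%N.
  rewrite lt0n; apply/eqP => r0.
  by apply: (minn i4 0 a42 1 0)%N; rewrite ?mnmE // /val4; lia.
have s_gt0 : (0 < a42)%N.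
  rewrite lt0n; apply/eqP => s0.
  by apply: (minn i3 0 0 0 r.+1)%N; rewrite ?mnmE // /val4; lia.
have lt_st : (a42 < t)%N.
  rewrite ltnNge; apply/negP => le_ts.
  apply: (minn i4 p.+1 (a42 - t) 0 0)%N; rewrite ?mnmE //.
  by move: row1 row4; rewrite -{1}(subnK le_ts) /val4; lia.
have [b [b_gt0 tE]] : exists b, (0 < b)%N /\ t = (a42 + b)%N.
  by exists (t - a42)%N; lia.
rewrite {}tE in A gens rfA row1 row2 row3 row4 lt_st *; rename a42 into s.
have {}row1 : (f + n i1 = (s + b) * n i2)%N by lia.
have {}row2 : (f + n i2 = q.+1 * n i3)%N by lia.
have {}row3 : (f + n i3 = p * n i1 + r * n i4)%N by lia.
have {}row4 : (f + n i4 = p * n i1 + s * n i2)%N by lia.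
have sgtypeE : sgtype H n = 2.
  exact: (sgtype_eq2 memH n_gt0 s_gt0 b_gt0 row1 row2 row3 row4 Hf HF Hgt PFf).
pose bin (u v : 'X_{1..4}) : {mpoly K[4]} := 'X_[u] - 'X_[v].
have binN u v : bin u v = - bin v u by rewrite /bin opprB.
have toricX u v : wdeg n u = wdeg n v -> toric_ideal K n (bin u v).
  exact: toric_idealXB.
have gensE : gens = [:: bin (mon4 0 (s + b).+1 0 0) (mon4 1 0 q.+1 0);
                        bin (mon4 p.+1 0 0 0) (mon4 0 b 0 1);
                        bin (mon4 0 0 q.+2 0) (mon4 p 1 0 r);
                        bin (mon4 0 0 q.+1 1) (mon4 p s.+1 0 0);
                        bin (mon4 0 0 0 r.+1) (mon4 0 s 1 0)].
  rewrite /gens /bin !mpolyX_mon4 !subn1 /= addKn addn1.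
  by rewrite !expr0 !expr1 ?mulr1 ?mul1r.
have RFE i j (u v : 'X_{1..4}) :
    (forall k, A i k - A j k = (u k)%:Z - (v k)%:Z) ->
    (forall k, u k = 0%N \/ v k = 0%N) -> RF_binomial K A i j = bin u v.
  exact: RF_binomialE.
have RF12 :
    RF_binomial K A i1 i2 = bin (mon4 0 (s + b).+1 0 0) (mon4 1 0 q.+1 0).
  by apply: RFE => k; rewrite /A; case: (ord4P k) => ->;
    rewrite ?mxE !mnmE /=; lia.
have RF14 : RF_binomial K A i1 i4 = bin (mon4 0 b 0 1) (mon4 p.+1 0 0 0).
  by apply: RFE => k; rewrite /A; case: (ord4P k) => ->;
    rewrite ?mxE !mnmE /=; lia.
have RF23 : RF_binomial K A i2 i3 = bin (mon4 0 0 q.+2 0) (mon4 p 1 0 r).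
  by apply: RFE => k; rewrite /A; case: (ord4P k) => ->;
    rewrite ?mxE !mnmE /=; lia.
have RF24 : RF_binomial K A i2 i4 = bin (mon4 0 0 q.+1 1) (mon4 p s.+1 0 0).
  by apply: RFE => k; rewrite /A; case: (ord4P k) => ->;
    rewrite ?mxE !mnmE /=; lia.
have RF34 : RF_binomial K A i3 i4 = bin (mon4 0 0 0 r.+1) (mon4 0 s 1 0).
  by apply: RFE => k; rewrite /A; case: (ord4P k) => ->;
    rewrite ?mxE !mnmE /=; lia.
have RF13 : RF_binomial K A i1 i3 = bin (mon4 0 (s + b) 1 0) (mon4 p.+1 0 0 r).
  by apply: RFE => k; rewrite /A; case: (ord4P k) => ->;
    rewrite ?mxE !mnmE /=; lia.
pose RFs := [:: RF_binomial K A i1 i2; RF_binomial K A i1 i4;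
  RF_binomial K A i2 i3; RF_binomial K A i2 i4; RF_binomial K A i3 i4].
have toric_RFs : toric_ideal K n = ideal_gen RFs.
  apply: (toric_ideal4 memH n_gt0 s_gt0 b_gt0 row1 row2 row3 row4 Hf HF)
    => [m|g]; rewrite !inE => /or4P[/eqP->|/eqP->|/eqP->|/orP[/eqP->|/eqP->]].
  - by apply: ideal_gen_opp; rewrite -/(bin _ _) -binN -RF12 !inE eqxx orbT.
  - by apply: ideal_gen_opp; rewrite -/(bin _ _) -binN -RF14 !inE eqxx !orbT.
  - by apply: ideal_gen_opp; rewrite -/(bin _ _) -RF23 !inE eqxx !orbT.
  - by apply: ideal_gen_opp; rewrite -/(bin _ _) -RF24 !inE eqxx !orbT.
  - by apply: ideal_gen_opp; rewrite -/(bin _ _) -RF34 !inE eqxx !orbT.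
  - by rewrite RF12; apply: toricX; rewrite !wdeg_mon4 /val4; lia.
  - by rewrite RF14; apply: toricX; rewrite !wdeg_mon4 /val4; lia.
  - by rewrite RF23; apply: toricX; rewrite !wdeg_mon4 /val4; lia.
  - by rewrite RF24; apply: toricX; rewrite !wdeg_mon4 /val4; lia.
  - by rewrite RF34; apply: toricX; rewrite !wdeg_mon4 /val4; lia.
(* Only the second generator has the opposite sign to its row difference. *)
have gensRF : gens = [:: RF_binomial K A i1 i2; - RF_binomial K A i1 i4;
    RF_binomial K A i2 i3; RF_binomial K A i2 i4; RF_binomial K A i3 i4].
  by rewrite gensE RF12 RF14 RF23 RF24 RF34 -binN.
have toric_gens : toric_ideal K n = ideal_gen gens.
  rewrite toric_RFs gensRF; apply: eq_ideal_gen => g;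
    rewrite !inE => /or4P[/eqP->|/eqP->|/eqP->|/orP[/eqP->|/eqP->]];
    by apply: ideal_gen_opp; rewrite !inE ?opprK eqxx ?orbT.
split; first split.
- rewrite FE.
  exact: (top_unique_factorization memH n_gt0 s_gt0 b_gt0 row1 row2 row3 row4).
- rewrite (apery_card memH n_gt0 s_gt0 b_gt0 row1 row2 row3 row4 Hf HF Hgt).
  by rewrite subn1.
- split=> //.
  + exists RFs; split=> // g; rewrite !inE.
    by case/or4P=> [/eqP->|/eqP->|/eqP->|/orP[/eqP->|/eqP->]];
      exists A; [exists i1, i2|exists i1, i4|exists i2, i3|exists i2, i4
                |exists i3, i4].
  + by lia.
  + move=> g; rewrite gensRF !inE.
    case/or4P=> [/eqP->|/eqP->|/eqP->|/orP[/eqP->|/eqP->]].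
    * by exists i1, i2; split=> //; left.
    * by exists i1, i4; split=> //; right.
    * by exists i2, i3; split=> //; left.
    * by exists i2, i4; split=> //; left.
    * by exists i3, i4; split=> //; left.
  (* The difference of rows 1 and 3 equals [x4^r u2 + x2^b u5]; as [r] and [b] are positive, both
     [u2] and [u5] have smaller weighted degree. *)
  pose u2 := bin (mon4 0 b 0 1) (mon4 p.+1 0 0 0).
  pose u5 := bin (mon4 0 s 1 0) (mon4 0 0 0 r.+1).
  apply: (not_minimal_generator (d := (p.+1 * n i1 + r * n i4)%N)
    (us := [:: u2; u5])).
  + by rewrite RF13; apply: whdegXB; rewrite wdeg_mon4 /val4; lia.
  + rewrite RF13.
    rewrite (_ : bin _ _ = 'X_[mon4 0 0 0 r] * u2 + 'X_[mon4 0 b 0 0] * u5).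
      have I := ideal_gen_closed [:: u2; u5].
      by apply: (ideal_closedD I); apply: (ideal_closedM I);
        apply: mem_ideal_gen; rewrite !inE eqxx ?orbT.
    rewrite /u2 /u5 /bin !mulrBr -!mpolyXD -!mon4D !addn0 !add0n.
    by rewrite addn1 (addnC b s); ring.
  move=> u; rewrite !inE => /orP[/eqP->|/eqP->]; split.
  + by apply: toricX; rewrite !wdeg_mon4 /val4; lia.
  + exists (p.+1 * n i1)%N;
      last by apply: whdegXB; rewrite wdeg_mon4 /val4; lia.
    by have : (0 < r * n i4)%N; [rewrite muln_gt0 r_gt0 n_gt0|lia].
  + by apply: toricX; rewrite !wdeg_mon4 /val4; lia.
  exists (r.+1 * n i4)%N; last by apply: whdegXB; rewrite wdeg_mon4 /val4; lia.
  have : (0 < b * n i2)%N by rewrite muln_gt0 b_gt0 n_gt0.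
  by lia.
split=> //; rewrite /almost_symmetric sgtypeE.
apply: (symmetric_gaps Hsg FE Hf) => x; rewrite FE.
exact: (gap_symmetric memH n_gt0 s_gt0 b_gt0 row1 row2 row3 row4).
Qed.
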